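(* Let $q$ be a prime power and let $m,d\ge 1$, $l$, $c$, $r$ be integers with $1\leq l\leq m$, $1\leq c\leq d$ and $$\binom{m+d}{d}-\binom{m+d+1-l}{d}+\binom{m+d-l-c}{d-c-1} <r \leq \binom{m+d}{d}.$$ Then given $F_1, \dots, F_r \in S_d(m)$ that are linearly independent over $\mathbb{F}_q$, we have $$\deg_{m-l}(V(F_1, \dots, F_r)) \leq c.$$
   Context: $\mathbb{F}_q$ is the finite field with $q$ elements and $\overline{\mathbb{F}}_q$ its algebraic closure. $S_d(m)$ is the $\mathbb{F}_q$-vector space of homogeneous polynomials of degree $d$ in $\mathbb{F}_q[x_0,\dots,x_m]$ (together with $0$). $V(F_1,\dots,F_r)\subseteq\mathbb{P}^m(\overline{\mathbb{F}}_q)$ is the common zero set of the $F_i$, a projective algebraic set over $\overline{\mathbb{F}}_q$. For an algebraic set $X$, $\deg_i(X)$ is the sum of the degrees of the irreducible components (over $\overline{\mathbb{F}}_q$) of $X$ of dimension exactly $i$ (it is $0$ if there are none). Binomial coefficients $\binom{a}{b}$ with $b<0$ are $0$. *)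

(* Defs.v *)
From HB Require Import structures.
From mathcomp Require Import all_boot all_order all_algebra.
From mathcomp Require Import mpoly.
From mathcomp Require Import mathcomp_extra boolp classical_sets functions.
From mathcomp Require Import cardinality fsbigop.

Set Implicit Arguments.
Unset Strict Implicit.
Unset Printing Implicit Defensive.

Import GRing.Theory.

Local Open Scope classical_set_scope.
Local Open Scope ring_scope.
Local Open Scope card_scope.

(* Unlike 'C(a, b - c) with truncated subtraction, this is 0 for b < 0. *)
Definition binz (a : nat) (b : int) : nat :=
  if b is Posz k then 'C(a, k) else 0%N.

Definition is_algebraic_closure (F : fieldType) (K : closedFieldType)
    (iota : {rmorphism F -> K}) : Prop :=
  forall x : K, algebraicOver iota x.

(* P^m(K), a point being a line through the origin of K^(m+1). *)
Definition projective_space (K : fieldType) (m : nat) : Type :=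
  {p : {vspace 'rV[K]_m.+1} | \dim p == 1%N}.

Section ProjectiveSets.
Variables (K : fieldType) (m : nat).

Local Notation PP := (projective_space K m).

Definition zero_locus (S : set {mpoly K[m.+1]}) : set PP :=
  [set p : PP | forall f, S f ->
    forall v : 'rV[K]_m.+1, v \in \val p -> f.@[v 0] = 0].

Definition algebraic_set (Z : set PP) : Prop :=
  exists2 S : set {mpoly K[m.+1]},
    (forall f, S f -> exists e : nat, f \is e.-homog) & Z = zero_locus S.

Definition irreducible_set (Z : set PP) : Prop :=
  [/\ algebraic_set Z, Z !=set0 &
      forall A B : set PP, algebraic_set A -> algebraic_set B ->
        Z `<=` A `|` B -> Z `<=` A \/ Z `<=` B].

Definition irreducible_component (X Z : set PP) : Prop :=
  [/\ irreducible_set Z, Z `<=` X &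
      forall Z', irreducible_set Z' -> Z `<=` Z' -> Z' `<=` X -> Z' = Z].

Definition irreducible_chain (X : set PP) (n : nat) : Prop :=
  exists W : nat -> set PP,
    (forall i, (i <= n)%N -> irreducible_set (W i) /\ W i `<=` X) /\
    (forall i, (i < n)%N -> W i `<` W i.+1).

(* Krull dimension: a chain of length n.+1 exists as soon as a longer one
   does. *)
Definition has_dimension (X : set PP) (n : nat) : Prop :=
  irreducible_chain X n /\ ~ irreducible_chain X n.+1.

(* The columns of A are the coefficient vectors of n linear forms. *)
Definition linear_section (n : nat) (A : 'M[K]_(m.+1, n)) : set PP :=
  [set p : PP | forall v : 'rV[K]_m.+1, v \in \val p -> v *m A = 0].

(* P holds on a nonempty Zariski open set of n-tuples of linear forms; such a
   set contains the non-vanishing locus of a nonzero polynomial in the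
   coefficients of these forms, and K is infinite in the intended use. *)
Definition for_general_forms (n : nat) (P : 'M[K]_(m.+1, n) -> Prop) : Prop :=
  exists2 Phi : {mpoly K[m.+1 * n]},
    Phi != 0 & forall A, Phi.@[mxvec A 0] != 0 -> P A.

(* The degree of an irreducible Z of dimension n: the number of points of Z on
   a general linear subspace of codimension n. Over an algebraically closed
   field this number exists and is unique, so 0 is never used as a default. *)
Definition degree (Z : set PP) : nat :=
  xget 0%N [set delta | exists2 n, has_dimension Z n &
    for_general_forms (fun A : 'M[K]_(m.+1, n) =>
      Z `&` linear_section A #= `I_delta)].

(* For algebraic X, the set of irreducible components is finite, and this is
   an ordinary finite sum. *)
Definition deg_dim (i : nat) (X : set PP) : nat :=
  \sum_(Z \in [set Z | irreducible_component X Z /\ has_dimension Z i]) degree Z.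

End ProjectiveSets.

(* The common zeros, over K, of forms with coefficients in the subfield F. *)
Definition projV (F K : fieldType) (iota : {rmorphism F -> K}) (m d r : nat)
    (Fs : r.-tuple (dhomog m.+1 F d)) : set (projective_space K m) :=
  zero_locus
    [set map_mpoly iota (mpoly_of_dhomog (tnth Fs i)) | i in [set: 'I_r]].

(* Main.v *)
Require Import Defs.
From HB Require Import structures.
From mathcomp Require Import all_boot all_order all_algebra.
From mathcomp Require Import mpoly zify.
From mathcomp Require Import mathcomp_extra boolp classical_sets functions.
From mathcomp Require Import cardinality fsbigop.

(* Put n = m - l and suppose that the n-dimensional components Z_i of V have
   total degree at least c + 1. Choose linear forms h_0, .., h_n, u. For a
   general a, the linear subspace h_j = a_j h_0 (1 <= j <= n) meets the Z_i in
   at least c + 1 points in all, none of them on h_0 = 0. If u / h_0 separates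
   these points, a form of degree d in h_0, .., h_n, u which has degree at most
   c in u and vanishes on V is a polynomial of degree at most c in u with c + 1
   roots for each such a, so it is zero. The monomials of this kind therefore
   span a complement to the span of the F_i, and there are
   C(n+1+d, d) - C(n+d-c, d-c-1) of them.

   Only the values of a in a finite grid are needed, so u has finitely many
   points to separate, and h_1, .., h_n can be chosen one after the other,
   together with the sides of the grid. At each step the form avoids the
   irreducible components of the sets cut out so far, which lowers the Krull
   dimension; this keeps the sections away from Z_i inter Z_j and from
   Z_i inter {h_0 = 0}, so that no elimination theory is required. *)

Set Implicit Arguments.
Unset Strict Implicit.
Unset Printing Implicit Defensive.

Import Order.TTheory GRing.Theory Num.Theory.
Local Open Scope ring_scope.

(** * Functions polynomial on lines *)

Lemma exists_nonroots (K : closedFieldType) (p : {poly K}) (N : nat) :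
  p != 0 -> exists e : 'I_N -> K, injective e /\ forall i, ~~ root p (e i).
Proof.
move=> p_neq0.
suff [s [s_uniq s_size s_nroot]] :
    exists s : seq K, [/\ uniq s, size s = N & all (fun x => ~~ root p x) s].
  exists (fun i => nth 0 s i); split=> [i j /eqP|i].
    by rewrite nth_uniq ?s_size // => /eqP/val_inj.
  by apply: (allP s_nroot); rewrite mem_nth ?s_size.
elim: N => [|N [s [s_uniq s_size s_nroot]]]; first by exists [::].
have /closed_nonrootP [x] : p * \prod_(a <- s) ('X - a%:P) != 0.
  by rewrite mulf_neq0 // monic_neq0 // monic_prod_XsubC.
rewrite rootM root_prod_XsubC negb_or => /andP [px xs].
by exists (x :: s); rewrite /= xs s_uniq s_size px s_nroot.
Qed.

(* This weak form of polynomiality is all that is needed to pick a point where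
   finitely many nonzero polynomial functions are simultaneously nonzero, and
   it spares a choice of coordinates on [V]. *)
Definition line_polynomial (K : fieldType) (V : lmodType K) (f : V -> K) :=
  forall u w : V, exists p : {poly K}, forall t, f (u + t *: w) = p.[t].

Section LinePolynomial.
Variables (K : closedFieldType) (V : lmodType K).

Lemma line_polynomial_prod (J : Type) (s : seq J) (P : pred J)
    (f : J -> V -> K) :
  (forall j, line_polynomial (f j)) ->
  line_polynomial (fun x => \prod_(j <- s | P j) f j x).
Proof.
move=> lp_f u w; have [p pE] := choice (fun j => lp_f j u w).
exists (\prod_(j <- s | P j) p j) => t.
by rewrite horner_prod; apply: eq_bigr => j _; rewrite pE.
Qed.

(** On the line joining a point where the product over the tail is nonzero to a point where [f j] is
    nonzero, both functions restrict to nonzero polynomials in one variable; a nonroot of their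
    product gives the point sought. *)
Lemma common_nonzero_seq (J : Type) (s : seq J) (f : J -> V -> K) :
  (forall j, line_polynomial (f j)) -> (forall j, exists x, f j x != 0) ->
  exists x, \prod_(j <- s) f j x != 0.
Proof.
move=> lp_f ex_f; elim: s => [|j s [x fx]].
  by exists 0; rewrite big_nil oner_neq0.
have [y fy] := ex_f j.
have [p pE] := lp_f j x (y - x).
have [q qE] := @line_polynomial_prod _ s predT _ lp_f x (y - x).
have : p * q != 0.
  rewrite mulf_neq0 //.
    apply: contraNneq fy => p0.
    by move: (pE 1); rewrite scale1r subrKC p0 horner0 => ->.
  apply: contraNneq fx => q0.
  by move: (qE 0); rewrite scale0r addr0 q0 horner0 => ->.
case/closed_nonrootP=> t; rewrite rootM negb_or => /andP [pt qt].
exists (x + t *: (y - x)); rewrite big_cons mulf_neq0 //.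
  by rewrite pE.
by rewrite qE.
Qed.

Lemma common_nonzero (J : finType) (f : J -> V -> K) :
  (forall j, line_polynomial (f j)) -> (forall j, exists x, f j x != 0) ->
  exists x, forall j, f j x != 0.
Proof.
move=> lp_f ex_f; have [x fx] := common_nonzero_seq (index_enum J) lp_f ex_f.
by exists x => j; move/prodf_neq0: fx => /(_ j); exact.
Qed.

(** Supplies one side of a grid: [x] is generic, and the [e i] are nonroots of the product of the
    [f j] restricted to the line through [x] with direction [- w]. *)
Lemma common_nonzero_translates (J : finType) (f : J -> V -> K) (w : V)
    (N : nat) :
  (forall j, line_polynomial (f j)) -> (forall j, exists x, f j x != 0) ->
  exists x, exists2 e : 'I_N -> K, injective e &
    forall i j, f j (x - e i *: w) != 0.
Proof.
move=> lp_f ex_f; have [x fx] := common_nonzero lp_f ex_f; exists x.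
have [p pE] := line_polynomial_prod (index_enum J) predT lp_f x (- w).
have p_neq0 : p != 0.
  apply/negP => /eqP p0; move: (pE 0).
  rewrite p0 horner0 scale0r addr0; apply/eqP.
  by apply/prodf_neq0 => j _.
have [e [e_inj eP]] := exists_nonroots N p_neq0; exists e => // i j.
move: (eP i); rewrite /root -pE => /prodf_neq0 /(_ j isT).
by rewrite scalerN.
Qed.

End LinePolynomial.

(** * The Noetherian topology of projective space *)

Lemma nondecreasing_subseq (u : nat -> nat) :
  exists2 phi : nat -> nat, {homo phi : i j / (i < j)%N} &
    {homo u \o phi : i j / (i <= j)%N}.
Proof.
(* Beyond any position the sequence attains the minimum of its remaining terms; jumping from one
   such position to the next gives nondecreasing values. *)
have min_after N :
    exists k, (N <= k)%N /\ forall j, (N <= j)%N -> (u k <= u j)%N.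
  have ex : exists x, `[< exists2 k, (N <= k)%N & u k = x >].
    by exists (u N); apply/asboolP; exists N.
  case: (ex_minnP ex) => x /asboolP [k Nk <-] xmin.
  by exists k; split=> // j Nj; apply: xmin; apply/asboolP; exists j.
have [next nextP] := choice min_after.
pose phi := fix phi i := if i is j.+1 then next (phi j).+1 else next 0%N.
have phi_lt i : (phi i < phi i.+1)%N by have [] := nextP (phi i).+1.
exists phi; first exact: (homo_ltn ltn_trans).
apply: (homo_leq (@leqnn) leq_trans) => i /=.
case: i => [|i]; first by have [_ min_next] := nextP 0%N; apply: min_next.
have [_ min_next] := nextP (phi i).+1; apply: min_next.
exact: ltn_trans (phi_lt i) (phi_lt i.+1).
Qed.

(** Refining the sequence once per coordinate yields a subsequence that is nondecreasing in all of
    them; its first two terms are comparable. *)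
Lemma dickson (n : nat) (t : nat -> 'X_{1..n}) :
  exists i j, (i < j)%N /\ (t i <= t j)%MM.
Proof.
suff [phi phi_mono t_mono] : exists2 phi : nat -> nat,
    {homo phi : i j / (i < j)%N} &
    forall l, l \in enum 'I_n ->
      {homo (fun k => t (phi k) l) : i j / (i <= j)%N}.
  exists (phi 0%N), (phi 1%N); split; first exact: phi_mono.
  by apply/mnm_lepP => l; apply: (t_mono l) => //; rewrite mem_enum.
elim: (enum 'I_n) => [|l s [phi phi_mono t_mono]]; first by exists id.
have [psi psi_mono t_psi] := nondecreasing_subseq (fun k => t (phi k) l).
exists (phi \o psi) => [i j ij|l' /[!inE] /predU1P [->|l's]].
- by apply: phi_mono; apply: psi_mono.
- exact: t_psi.
- move=> i j ij; apply: (t_mono l' l's); move: ij.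
  by rewrite leq_eqVlt => /predU1P [->|/psi_mono/ltnW].
Qed.

Section AlgebraicSets.
Local Open Scope classical_set_scope.
Variables (K : fieldType) (m : nat).
Local Notation PP := (projective_space K m).
Implicit Types (Z W A B : set PP) (f g : {mpoly K[m.+1]}) (p : PP).

(** The ideal of the affine cone over [Z]. Inhomogeneous elements are allowed, so that reduction of
    leading terms stays inside it. *)
Definition vanishing_ideal Z : set {mpoly K[m.+1]} :=
  [set f | forall p, Z p ->
    forall v : 'rV[K]_m.+1, v \in \val p -> f.@[v 0] = 0].

Lemma vanishing_idealS Z W : Z `<=` W -> vanishing_ideal W `<=` vanishing_ideal Z.
Proof. by move=> ZW f fW p /ZW; apply: fW. Qed.

Lemma vanishing_idealB Z f g c u :
  vanishing_ideal Z f -> vanishing_ideal Z g ->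
  vanishing_ideal Z (f - c *: ('X_[u] * g)).
Proof.
move=> fZ gZ p Zp v vp.
by rewrite mevalB mevalZ mevalM (fZ p) // (gZ p) // !mulr0 subr0.
Qed.

Lemma algebraic_set_separated Z W : algebraic_set W -> ~ Z `<=` W ->
  exists2 f, vanishing_ideal W f & ~ vanishing_ideal Z f.
Proof.
move=> [S _ ->]; apply: contra_notP => /forall2NP fZ p Zp f Sf v vp.
case: (fZ f) => [nfW|/contrapT fvan]; last exact: fvan Zp v vp.
by case: nfW => q Wq w wq; apply: Wq.
Qed.

(* A strictly decreasing sequence of zero sets yields polynomials of minimal
   leading monomial separating consecutive terms; Dickson's lemma lets one of
   them be reduced by an earlier one, contradicting minimality. *)
Lemma algebraic_set_dcc (Z : nat -> set PP) :
  (forall k, algebraic_set (Z k)) -> ~ (forall k, Z k.+1 `<` Z k).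
Proof.
move=> algZ decZ.
pose sep k f := vanishing_ideal (Z k.+1) f /\ ~ vanishing_ideal (Z k) f.
have ex_sep k : exists f, sep k f /\
    forall g, sep k g -> ~ (mlead g < mlead f)%O.
  have [f0 f0Z nf0Z] :
      exists2 f, vanishing_ideal (Z k.+1) f & ~ vanishing_ideal (Z k) f.
    by apply: algebraic_set_separated => //; case: (decZ k).
  apply: contrapT => /forallNP nex.
  have /(_ f0) : forall f, ~ sep k f; last by apply.
  apply: mleadrect => f IH fsep; apply: (nex f); split=> // g gsep gf.
  exact: (IH g gf).
have [f fP] := choice ex_sep.
have Zmono : {homo Z : i j / (i <= j)%N >-> j `<=` i}.
  apply: homo_leq => [A|A B C AB BC|k]; first by [].
    exact: subset_trans BC AB.
  by case: (decZ k).
have [i [j [ij lij]]] := dickson (fun k => mlead (f k)).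
have [[fi_van fi_nvan] _] := fP i.
have [[fj_van fj_nvan] fj_min] := fP j.
have f_neq0 k : f k != 0.
  have [[_ nvan] _] := fP k.
  by apply: contra_notN nvan => /eqP -> p _ v _; rewrite meval0.
pose mo := (mlead (f j) - mlead (f i))%MM.
have moE : (mo + mlead (f i) = mlead (f j))%MM by rewrite submK.
pose h := 'X_[mo] * f i.
have lead_h : mlead h = mlead (f j).
  rewrite /h mleadM ?f_neq0 ?mleadXm //.
  by rewrite -mleadc_eq0 mleadXm mcoeffX eqxx oner_neq0.
have h_neq0 : h != 0.
  rewrite mulf_neq0 ?f_neq0 //.
  by rewrite -mleadc_eq0 mleadXm mcoeffX eqxx oner_neq0.
(* The leading terms cancel, while [g] still separates the same two sets because [f i] vanishes on
   [Z i.+1], which contains [Z j]. *)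
pose g := f j - (mleadc (f j) / mleadc h) *: h.
have g_coef : g@_(mlead (f j)) = 0.
  by rewrite mcoeffB mcoeffZ lead_h divfK ?subrr // -lead_h mleadc_eq0.
have fi_vanj : vanishing_ideal (Z j) (f i).
  exact: vanishing_idealS (Zmono _ _ ij) _ fi_van.
have g_sep : sep j g.
  split.
    apply: vanishing_idealB => //.
    by apply: vanishing_idealS fi_vanj; exact: Zmono.
  move=> gvan; apply: fj_nvan.
  have -> : f j = g - (- (mleadc (f j) / mleadc h)) *: h.
    by rewrite scaleNr opprK /g subrK.
  exact: vanishing_idealB.
have g_neq0 : g != 0.
  by case: g_sep => _; apply: contra_notN => /eqP -> p _ v _; rewrite meval0.
apply: (fj_min g g_sep); rewrite lt_neqAle; apply/andP; split.
  by apply: contra_neq g_neq0 => gE; apply/eqP; rewrite -mleadc_eq0 gE g_coef.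
apply: le_trans (mleadB_le _ _) _; rewrite leUx lexx /=.
by rewrite (le_trans (mleadZ_le _ _)) ?lead_h.
Qed.

(** Noetherian induction: if every counterexample properly contained another one, iteration would
    contradict [algebraic_set_dcc]. *)
Lemma algebraic_set_ind (P : set PP -> Prop) :
  (forall Z, algebraic_set Z ->
    (forall W, algebraic_set W -> W `<` Z -> P W) -> P Z) ->
  forall Z, algebraic_set Z -> P Z.
Proof.
move=> IH Z0 algZ0; apply: contrapT => nPZ0.
pose bad := {Z : set PP | algebraic_set Z /\ ~ P Z}.
have smaller (b : bad) : exists b' : bad, sval b' `<` sval b.
  case: b => Z [algZ nPZ] /=; apply: contrapT => /forallNP nex.
  apply: nPZ; apply: IH => // W algW WZ; apply: contrapT => nPW.
  exact: (nex (exist _ W (conj algW nPW))).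
have [next nextP] := choice smaller.
pose b0 : bad := exist _ Z0 (conj algZ0 nPZ0).
apply: (@algebraic_set_dcc (fun k => sval (iter k next b0))) => k.
  by case: (svalP (iter k next b0)).
exact: nextP.
Qed.

Lemma algebraic_set0 : algebraic_set (set0 : set PP).
Proof.
exists [set 1] => [f -> |]; first by exists 0%N; rewrite dhomog1.
apply/seteqP; split=> // p /(_ 1 erefl 0 (mem0v _)) /eqP.
by rewrite meval1 oner_eq0.
Qed.

Lemma algebraic_setI A B :
  algebraic_set A -> algebraic_set B -> algebraic_set (A `&` B).
Proof.
move=> [S homS ->] [T homT ->]; exists (S `|` T) => [f []|]; [exact: homS|exact: homT|].
apply/seteqP; split=> [p [Sp Tp] f [/Sp|/Tp]|p STp] //.
by split=> f Hf; apply: STp; [left|right].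
Qed.

Lemma meval_homogZ f e c (v : 'rV[K]_m.+1) :
  f \is e.-homog -> f.@[(c *: v) 0] = c ^+ e * f.@[v 0].
Proof.
move=> /dhomogP homf; rewrite !mevalE mulr_sumr; apply: eq_big_seq => u uf.
rewrite mulrCA; congr (_ * _).
under eq_bigr do rewrite mxE exprMn.
by rewrite big_split /= prodrXr -mdegE (homf u).
Qed.

Lemma projective_point_line p (v : 'rV[K]_m.+1) :
  v \in \val p -> v != 0 -> \val p = <[v]>%VS.
Proof.
case: p => p /= /eqP dimp vp v0; apply/esym/eqP.
by rewrite eqEdim -memvE vp dim_vline v0 dimp.
Qed.

Lemma zero_locusP (S : set {mpoly K[m.+1]}) p v :
  (forall f, S f -> exists e : nat, f \is e.-homog) ->
  v \in \val p -> v != 0 ->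
  zero_locus S p <-> forall f, S f -> f.@[v 0] = 0.
Proof.
move=> homS vp v0; split=> [Sp f /Sp|Sv f Sf w]; first exact.
rewrite (projective_point_line vp v0) => /vlineP [c ->].
by have [e /meval_homogZ ->] := homS f Sf; rewrite Sv // mulr0.
Qed.

Definition repr_vector p : 'rV[K]_m.+1 := vpick (\val p).

Lemma repr_vector_in p : repr_vector p \in \val p.
Proof. exact: memv_pick. Qed.

Lemma repr_vector_neq0 p : repr_vector p != 0.
Proof. by rewrite vpick0 -dimv_eq0; case: p => p /= /eqP ->. Qed.

Lemma algebraic_setU A B :
  algebraic_set A -> algebraic_set B -> algebraic_set (A `|` B).
Proof.
move=> [S homS ->] [T homT ->]; pose ST := [set fg.1 * fg.2 | fg in S `*` T].
have homST f : ST f -> exists e : nat, f \is e.-homog.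
  move=> [[g h] /= [/homS [d homg] /homT [e homh]] <-].
  by exists (d + e)%N; exact: dhomogM.
exists ST => //; apply/seteqP; split=> [p [Sp|Tp] _ [[g h] [Sg Th] <-] v vp|p STp].
- by rewrite mevalM /= (Sp g) // mul0r.
- by rewrite mevalM /= (Tp h) // mulr0.
have vp := repr_vector_in p; have v0 := repr_vector_neq0 p.
apply: contrapT => /not_orP [/(zero_locusP homS vp v0) nS].
move=> /(zero_locusP homT vp v0) nT; apply: nS => g Sg.
apply: contrapT => /eqP ng; apply: nT => h Th.
have /(zero_locusP homST vp v0) /(_ (g * h)) STv := STp.
have /eqP : (g * h).@[repr_vector p 0] = 0 by apply: STv; exists (g, h).
by rewrite mevalM mulf_eq0 (negPf ng) => /eqP.
Qed.

Definition hyperplane (h : 'cV[K]_m.+1) : set PP :=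
  [set p : PP | forall v : 'rV[K]_m.+1, v \in \val p -> v *m h = 0].

Definition linear_form (h : 'cV[K]_m.+1) : {mpoly K[m.+1]} :=
  \sum_i h i 0 *: 'X_i.

Lemma linear_form_homog h : linear_form h \is 1.-homog.
Proof. by apply: rpred_sum => i _; rewrite rpredZ // dhomogX /= mdeg1. Qed.

Lemma linear_form_exp_homog h k : linear_form h ^+ k \is k.-homog.
Proof. by have := dhomogMn k (linear_form_homog h); rewrite mul1n. Qed.

Lemma linear_formE h (v : 'rV_m.+1) : (linear_form h).@[v 0] = (v *m h) 0 0.
Proof.
rewrite /linear_form raddf_sum mxE; apply: eq_bigr => i _ /=.
by rewrite mevalZ mevalXU mulrC.
Qed.

Lemma algebraic_hyperplane h : algebraic_set (hyperplane h).
Proof.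
exists [set linear_form h] => [f ->|]; first by exists 1%N; exact: linear_form_homog.
apply/seteqP; split=> [p hp f -> v vp|p hp v vp].
  by rewrite linear_formE hp ?mxE.
apply/matrixP => i j; rewrite !ord1 [RHS]mxE -linear_formE.
exact: (hp _ erefl).
Qed.

Lemma algebraic_bigcup_seq (J : eqType) (s : seq J) (A : J -> set PP) :
  (forall j, algebraic_set (A j)) ->
  algebraic_set [set p | exists2 j, j \in s & A j p].
Proof.
move=> algA; elim: s => [|j s IH].
  suff -> : [set p | exists2 j, j \in [::] & A j p] = set0 by exact: algebraic_set0.
  by apply/seteqP; split=> // p [].
suff -> : [set p | exists2 i, i \in j :: s & A i p] =
          A j `|` [set p | exists2 i, i \in s & A i p] by exact: algebraic_setU.
apply/seteqP; split=> [p [i /[!inE] /predU1P [->|si] Aip]|p [Ajp|[i si Aip]]].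
- by left.
- by right; exists i.
- by exists j; rewrite ?inE ?eqxx.
- by exists i; rewrite ?inE ?si ?orbT.
Qed.

Lemma irreducible_sub_bigcup (J : finType) (A : J -> set PP) W :
  (forall j, algebraic_set (A j)) -> irreducible_set W ->
  W `<=` \bigcup_j A j -> exists j, W `<=` A j.
Proof.
move=> algA [_ [p0 Wp0] irrW] WA.
have : W `<=` [set p | exists2 j, j \in enum J & A j p].
  by move=> p /WA [j _ Ajp]; exists j; rewrite ?mem_enum.
elim: (enum J) => [/(_ p0 Wp0) []//|j s IH WAs].
have algs := algebraic_bigcup_seq s algA.
case: (irrW (A j) _ (algA j) algs) => [p|WAj|/IH //]; last by exists j.
by move=> /WAs [i /[!inE] /predU1P [->|si] Aip]; [left|right; exists i].
Qed.

(** By Noetherian induction: a nonempty reducible set is the union of its intersections with two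
    algebraic sets, neither of which contains it. The pieces [W j] may be contained in one
    another. *)
Lemma irreducible_decomposition Z : algebraic_set Z ->
  exists (J : finType) (W : J -> set PP),
    (forall j, irreducible_set (W j)) /\ Z = \bigcup_j W j.
Proof.
move: Z; apply: algebraic_set_ind => Z algZ IH.
have [Z0|/set0P Zne] := eqVneq Z set0.
  exists void, (fun=> set0); split=> [[]|].
  by rewrite Z0; apply/seteqP; split=> // p [[]].
have [irrZ|redZ] := pselect (irreducible_set Z).
  exists unit, (fun=> Z); split=> //.
  by apply/seteqP; split=> [p Zp|p [] //]; exists tt.
have [A [B [algA [algB [ZAB [nZA nZB]]]]]] : exists A B, algebraic_set A /\
    (algebraic_set B /\ (Z `<=` A `|` B /\ (~ Z `<=` A /\ ~ Z `<=` B))).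
  apply: contrapT => nex; apply: redZ; split=> // A B algA algB ZAB.
  apply: contrapT => /not_orP [nZA nZB]; apply: nex.
  by exists A, B.
have sub C : algebraic_set C -> ~ Z `<=` C -> exists (J : finType) (W : J -> set PP),
    (forall j, irreducible_set (W j)) /\ Z `&` C = \bigcup_j W j.
  move=> algC nZC; apply: IH; first exact: algebraic_setI.
  by split=> [p []|ZC] //; apply: nZC => p /ZC [].
have [J1 [W1 [irr1 ZA]]] := sub A algA nZA.
have [J2 [W2 [irr2 ZB]]] := sub B algB nZB.
exists (J1 + J2)%type, (fun j => match j with inl j => W1 j | inr j => W2 j end).
split=> [[j|j]//|]; apply/seteqP; split=> [p Zp|p [[j|j] _ Wp]].
- have [Ap|Bp] := ZAB p Zp.
    have : (Z `&` A) p by []; rewrite ZA => -[j _ Wp]; by exists (inl j).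
  have : (Z `&` B) p by []; rewrite ZB => -[j _ Wp]; by exists (inr j).
- have : (Z `&` A) p by [rewrite ZA; exists j]; by case.
- have : (Z `&` B) p by [rewrite ZB; exists j]; by case.
Qed.

End AlgebraicSets.

(** * Krull dimension and linear sections *)

Section Dimension.
Local Open Scope classical_set_scope.
Variables (K : fieldType) (m : nat).
Local Notation PP := (projective_space K m).
Implicit Types (Z W X Y : set PP) (p : PP).

Lemma irreducible_algebraic Z : irreducible_set Z -> algebraic_set Z.
Proof. by case. Qed.

Lemma irreducible_chain_leq X n k :
  (k <= n)%N -> irreducible_chain X n -> irreducible_chain X k.
Proof.
move=> kn [W [irrW decW]]; exists W; split=> i ik.
  by apply: irrW; apply: leq_trans ik kn.
by apply: decW; apply: leq_trans ik kn.
Qed.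

Lemma has_dimension_unique X n k :
  has_dimension X n -> has_dimension X k -> n = k.
Proof.
move=> [chn nchn] [chk nchk]; case: (ltngtP n k) => // lt.
  by case: nchn; apply: irreducible_chain_leq chk.
by case: nchk; apply: irreducible_chain_leq chn.
Qed.

(** Putting [Z] on top of a chain in [Y] makes the chain one step longer. *)
Lemma proper_subset_chain Z Y r : irreducible_set Z -> Y `<` Z ->
  ~ irreducible_chain Z r.+1 -> ~ irreducible_chain Y r.
Proof.
move=> irrZ [YZ nZY] nchZ [W [irrW decW]]; apply: nchZ.
have WrY : W r `<=` Y by case: (irrW r (leqnn r)).
exists (fun i => if (i <= r)%N then W i else Z); split=> i.
  move=> _; case: ifP => [ir|_]; last by split.
  have [irrWi WiY] := irrW i ir.
  by split=> //; apply: subset_trans WiY YZ.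
rewrite ltnS => ir; rewrite ir; case: ltnP => [ltir|leri]; first exact: decW.
have -> : i = r by apply/eqP; rewrite eqn_leq ir leri.
by split; [exact: subset_trans WrY YZ|move=> /subset_trans /(_ WrY)].
Qed.

Lemma no_chain_empty Y : algebraic_set Y -> ~ irreducible_chain Y 0 ->
  forall p, ~ Y p.
Proof.
move=> algY nch p; have [J [W [irrW YE]]] := irreducible_decomposition algY.
rewrite YE => -[j _ _]; apply: nch; exists (fun=> W j); split=> // i _.
by split=> //; rewrite YE => q Wq; exists j.
Qed.

Lemma line_polynomial_mulmx (v : 'rV[K]_m.+1) :
  line_polynomial (fun h : 'cV[K]_m.+1 => (v *m h) 0 0).
Proof.
move=> u w; exists (((v *m u) 0 0)%:P + (v *m w) 0 0 *: 'X) => t.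
by rewrite mulmxDr -scalemxAr mxE [X in _ + X]mxE !hornerE mulrC.
Qed.

Lemma mulmx_cV_neq0 (v : 'rV[K]_m.+1) :
  v != 0 -> exists h : 'cV[K]_m.+1, (v *m h) 0 0 != 0.
Proof.
case/rV0Pn => i vi; exists (delta_mx i 0).
by rewrite -colE mxE.
Qed.

Lemma not_hyperplane p (h : 'cV[K]_m.+1) :
  (repr_vector p *m h) 0 0 != 0 -> ~ hyperplane h p.
Proof. by move=> /eqP nz /(_ _ (repr_vector_in p)) vh; apply: nz; rewrite vh mxE. Qed.

End Dimension.

(** * Grids of hyperplanes avoiding algebraic sets of small dimension *)

Section Grid.
Local Open Scope classical_set_scope.
Variables (K : closedFieldType) (m : nat).
Local Notation PP := (projective_space K m).
Local Notation CV := 'cV[K]_m.+1.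
Implicit Types (Z W X Y : set PP) (p : PP).

(** Take for [psi h] the product of the values of [h] at one chosen point of each irreducible piece
    of [Y]. If it is nonzero, the hyperplane contains no piece; a chain in the section then lies in
    a proper subset of some piece, and that piece extends the chain. *)
Lemma hyperplane_section_chain Y r :
  algebraic_set Y -> ~ irreducible_chain Y r.+1 ->
  exists psi : CV -> K,
    [/\ line_polynomial psi, exists h, psi h != 0 &
        forall h, psi h != 0 -> ~ irreducible_chain (Y `&` hyperplane h) r].
Proof.
move=> algY nch; have [J [W [irrW YE]]] := irreducible_decomposition algY.
have ne j : exists p, W j p by case: (irrW j).
have [q qW] := choice ne.
pose ev (j : J) (h : CV) := (repr_vector (q j) *m h) 0 0.
have lp_ev j : line_polynomial (ev j) by exact: line_polynomial_mulmx.
exists (fun h => \prod_(j : J) ev j h); split.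
- exact: line_polynomial_prod.
- apply: common_nonzero_seq => // j; apply: mulmx_cV_neq0.
  exact: repr_vector_neq0.
move=> h /prodf_neq0 hP [C [irrC decC]].
have [irrCr CrY] := irrC r (leqnn r).
have [j CrWj] : exists j, C r `<=` W j.
  apply: irreducible_sub_bigcup => // [j|]; first exact: irreducible_algebraic.
  by rewrite -YE => p /CrY [].
have nchW : ~ irreducible_chain (W j) r.+1.
  apply: contra_not nch => -[D [irrD decD]]; exists D; split=> // i ir.
  have [irrDi DiW] := irrD i ir; split=> // p /DiW Wp.
  by rewrite YE; exists j.
have subW : W j `&` hyperplane h `<` W j.
  split; first exact: subIsetl.
  by move=> /(_ _ (qW j)) [_]; apply: not_hyperplane; apply: hP.
apply: (proper_subset_chain (irrW j) subW nchW).
exists C; split=> // i ir; have [irrCi CiY] := irrC i ir; split=> // p Cp.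
have [_ hp] := CiY p Cp; split=> //; apply: CrWj.
have Cmono k : (i + k <= r)%N -> C (i + k)%N p.
  elim: k => [|k IH]; rewrite ?addn0 // addnS => ikr.
  by case: (decC _ ikr) => sub _; apply: sub; apply: IH; apply: ltnW.
by have := Cmono (r - i)%N; rewrite subnKC //; apply.
Qed.

Definition scons (T : Type) (x : T) (f : nat -> T) (i : nat) : T :=
  if i is k.+1 then f k else x.

Lemma line_polynomial_scons (phi : (nat -> CV) -> K) (f : nat -> CV) :
  line_polynomial phi -> line_polynomial (fun x => phi (scons x f)).
Proof.
move=> lp u w; have [p pE] := lp (scons u f) (scons w (fun=> 0)).
exists p => t; rewrite -pE; congr phi; apply/funext => -[|i] //=.
by rewrite /GRing.add /= /GRing.scale /= scaler0 addr0.
Qed.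

Lemma line_polynomial_sconsl (phi : (nat -> CV) -> K) (x : CV) :
  line_polynomial phi -> line_polynomial (fun f => phi (scons x f)).
Proof.
move=> lp u w; have [p pE] := lp (scons x u) (scons 0 w).
exists p => t; rewrite -pE; congr phi; apply/funext => -[|i] //=.
by rewrite /GRing.add /= /GRing.scale /= scaler0 addr0.
Qed.

(** Induction on [r]. All [N] translates of the first form are made generic at once, and the index
    set grows to [J * 'I_N], so that the later forms suit every choice of translate; hence [h] and
    [e] do not depend on [a]. Each form lowers the dimension bound by one until nothing is left. As
    [phi j] may read the whole sequence, it is evaluated at some [g] extending the first [r]
    forms. *)
Lemma grid_avoidance (h0 : CV) (N r : nat) (J : finType)
    (phi : J -> (nat -> CV) -> K) (Y : J -> set PP) :
  (forall j, line_polynomial (phi j)) -> (forall j, exists f, phi j f != 0) ->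
  (forall j, algebraic_set (Y j)) -> (forall j, ~ irreducible_chain (Y j) r) ->
  exists (h : nat -> CV) (e : nat -> 'I_N -> K),
    (forall i, (i < r)%N -> injective (e i)) /\
    forall j (a : nat -> 'I_N),
      (exists2 g, phi j g != 0 &
        forall i, (i < r)%N -> g i = h i - e i (a i) *: h0) /\
      forall p, Y j p ->
        ~ forall i, (i < r)%N -> hyperplane (h i - e i (a i) *: h0) p.
Proof.
elim: r J phi Y => [|r IH] J phi Y lp_phi nz_phi algY nchY.
  exists (fun=> 0), (fun _ _ => 0); split=> // j a; split.
    by have [f fP] := nz_phi j; exists f.
  by move=> p Yp _; apply: (no_chain_empty (algY j) (nchY j)) Yp.
have [f fP] := choice nz_phi.
have [psi psiP] := choice (fun j => hyperplane_section_chain (algY j) (nchY j)).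
(* The boolean selects one of two conditions on the first form: lowering the dimension of [Y j], or
   keeping [phi j] nonzero when completed by the tail of the fixed witness [f j]. *)
pose F (jb : J * bool) :=
  if jb.2 then psi jb.1 else fun x => phi jb.1 (scons x (fun i => f jb.1 i.+1)).
have lp_F jb : line_polynomial (F jb).
  case: jb => j [] /=; first by have [] := psiP j.
  exact: line_polynomial_scons.
have nz_F jb : exists x, F jb x != 0.
  case: jb => j [] /=; first by have [] := psiP j.
  exists (f j 0%N); rewrite /F /=.
  by rewrite [X in phi j X](_ : _ = f j) //; apply/funext => -[].
have [x [e e_inj eP]] := common_nonzero_translates h0 N lp_F nz_F.
pose c i := x - e i *: h0.
have [| | | |h' [e' [e'_inj e'P]]] := IH (J * 'I_N)%type
  (fun ji f => phi ji.1 (scons (c ji.2) f))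
  (fun ji => Y ji.1 `&` hyperplane (c ji.2)).
- by move=> [j i]; apply: line_polynomial_sconsl.
- by move=> [j i]; exists (fun i => f j i.+1); exact: (eP i (j, false)).
- by move=> [j i]; apply: algebraic_setI => //; exact: algebraic_hyperplane.
- by move=> [j i] /=; have [_ _] := psiP j; apply; exact: (eP i (j, true)).
exists (scons x h'), (scons e e'); split=> [[|i]|j a] //=; first exact: e'_inj.
have [[g gP gE] Yempty] := e'P (j, a 0%N) (a \o S).
split; first by exists (scons (c (a 0%N)) g) => // -[|i] //= /gE.
move=> p Yp hp; apply: (Yempty p); first by split=> //; exact: (hp 0%N).
by move=> i ir; exact: (hp i.+1).
Qed.

End Grid.

(** * Grids, monomials and ranks *)

(** The columns of the inverse Vandermonde matrix recover the coefficients of a polynomial of degree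
    less than [N] from its values at the nodes [e a]. *)
Lemma vandermonde_dual (K : fieldType) (N : nat) (e : 'I_N -> K) :
  injective e -> exists L : 'I_N -> 'I_N -> K,
    forall s t : 'I_N, \sum_a L s a * e a ^+ t = (s == t)%:R.
Proof.
move=> e_inj; pose V := Vandermonde N (\row_a e a).
have V_unit : V \in unitmx.
  rewrite unitmxE det_Vandermonde unitfE; apply/prodf_neq0 => i _.
  apply/prodf_neq0 => j ij; rewrite !mxE subr_eq0 (inj_eq e_inj).
  by apply: contraTneq ij => ->; rewrite ltnn.
exists (fun s a => invmx V a s) => s t.
have /matrixP /(_ t s) := mulmxV V_unit.
rewrite !mxE eq_sym => <-; apply: eq_bigr => a _.
by rewrite !mxE mulrC.
Qed.

(** The tensor product of the functionals of [vandermonde_dual] over the [n] directions reads off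
    [b s] from the values on the grid. *)
Lemma grid_independence (K : fieldType) (n N : nat) (e : 'I_n -> 'I_N -> K)
    (b : {ffun 'I_n -> 'I_N} -> K) :
  (forall i, injective (e i)) ->
  (forall a : {ffun 'I_n -> 'I_N}, \sum_t b t * \prod_i e i (a i) ^+ t i = 0) ->
  forall t, b t = 0.
Proof.
move=> e_inj b0 s.
have [L LP] := choice (fun i => vandermonde_dual (e_inj i)).
have -> : b s = \sum_t b t * \prod_i \sum_a L i (s i) a * e i a ^+ t i.
  rewrite (bigD1 s) //= [X in _ + X]big1 ?addr0 => [|t ts].
    by rewrite big1 ?mulr1 // => i _; rewrite LP eqxx.
  have [i si] : exists i, s i != t i.
    apply/existsP; apply: contraR ts; rewrite negb_exists => /forallP ts.
    by apply/eqP/ffunP => i; have := ts i; rewrite negbK => /eqP.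
  by rewrite (bigD1 i) //= LP (negPf si) mul0r mulr0.
under eq_bigr => t _ do rewrite bigA_distr_bigA mulr_sumr.
rewrite exchange_big big1 //= => a _.
under eq_bigr => t _ do rewrite big_split /= mulrCA.
by rewrite -mulr_sumr b0 mulr0.
Qed.

(** All exponents occurring in [p] are below [N], so vanishing on a grid with [N] nodes per
    direction would make every coefficient zero. *)
Lemma mpoly_nonzero_point (K : closedFieldType) (n : nat) (p : {mpoly K[n]}) :
  p != 0 -> exists v : 'I_n -> K, p.@[v] != 0.
Proof.
move=> p_neq0; apply: contrapT => /forallNP p0.
pose N := (msize p).+1.
have [e [e_inj _]] := exists_nonroots N (oner_neq0 {poly K}).
pose mon (t : {ffun 'I_n -> 'I_N}) : 'X_{1..n} := [multinom val (t i) | i < n].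
have mon_inj : injective mon.
  move=> s t /mnmP st; apply/ffunP => i; apply/val_inj.
  by have := st i; rewrite !mnmE.
have supp_mon u : u \in msupp p -> u \in codom mon.
  move=> up; have ltu i : (u i < N)%N.
    rewrite ltnS; apply: leq_trans (ltnW (msize_mdeg_lt up)).
    by rewrite mdegE (bigD1 i) //= leq_addr.
  apply/codomP; exists [ffun i => Ordinal (ltu i)].
  by apply/mnmP => i; rewrite mnmE ffunE.
have coef0 : forall t, p@_(mon t) = 0.
  apply: (grid_independence (e := fun=> e)) => // a.
  have /negP/negPn/eqP p_a := p0 (fun i => e (a i)).
  rewrite -[RHS]p_a mevalE.
  transitivity (\sum_(u <- codom mon) p@_u * \prod_i e (a i) ^+ u i).
    rewrite big_map enumT; apply: eq_bigr => t _; congr (_ * _).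
    by apply: eq_bigr => i _; rewrite mnmE.
  rewrite (bigID (mem (msupp p))) /= addrC big1 ?add0r => [|u up]; last first.
    by rewrite memN_msupp_eq0 ?mul0r.
  rewrite -big_filter; apply: perm_big; apply: uniq_perm.
  - by rewrite filter_uniq // map_inj_uniq ?enum_uniq.
  - exact: msupp_uniq.
  move=> u; rewrite mem_filter andbC.
  by case up: (u \in msupp p); rewrite ?andbF // supp_mon.
have /codomP [t tE] := supp_mon _ (mlead_supp p_neq0).
by have := coef0 t; rewrite -tE; apply/eqP; rewrite mleadc_eq0.
Qed.

Lemma dhomog_bigprod (R : comNzRingType) (n : nat) (J : Type) (s : seq J)
    (d : J -> nat) (F : J -> {mpoly R[n]}) :
  (forall j, F j \is (d j).-homog) ->
  \prod_(j <- s) F j \is (\sum_(j <- s) d j)%N.-homog.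
Proof.
move=> homF; elim/big_rec2: _ => [|j e f _ homf]; first exact: dhomog1.
exact: dhomogM.
Qed.

Lemma map_mpoly_homog (F K : fieldType) (iota : {rmorphism F -> K}) (n d : nat)
    (p : {mpoly F[n]}) :
  p \is d.-homog -> map_mpoly iota p \is d.-homog.
Proof.
move=> /dhomogP homp; apply/dhomogP => u.
by rewrite (perm_mem (msupp_map_mpoly p (fmorph_inj iota))); exact: homp.
Qed.

Lemma hockey_stick (n d c : nat) : (c <= d)%N ->
  (\sum_(k < c.+1) 'C(n + (d - k), n) + 'C(n + (d - c), n.+1)
   = 'C((n + d).+1, n.+1))%N.
Proof.
elim: c => [|c IH] cd; first by rewrite big_ord1 subn0 binS addnC.
rewrite big_ord_recr /= -IH ?(ltnW cd) // -addnA; congr addn.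
by rewrite -[in RHS](subnSK cd) addnS binS addnC.
Qed.

Lemma card_bounded_exponents (n d D : nat) : (D <= d)%N ->
  ('C(n + D, n) <=
   #|[set t : {ffun 'I_n -> 'I_d.+1} | \sum_i val (t i) <= D]|)%N.
Proof.
move=> Dd; have le : (D.+1 <= d.+1)%N by [].
rewrite -card_partial_ord_partitions.
pose f (t : n.-tuple 'I_D.+1) := [ffun i => widen_ord le (tnth t i)].
have f_inj : injective f.
  move=> s t /ffunP st; apply: eq_from_tnth => i; apply/val_inj.
  by have := congr1 val (st i); rewrite !ffunE.
rewrite -(card_imset _ f_inj); apply: subset_leq_card.
apply/fintype.subsetP => _ /imsetP [t tD ->].
move: tD; rewrite !inE big_tuple => /(leq_trans _); apply.
by apply: leq_sum => i _; rewrite ffunE.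
Qed.

(** The first entry is the exponent of [u], at most [c]; the others are those of [h_1, .., h_n], and
    [h_0] takes the missing degree. The count is summed over the first entry. *)
Lemma card_exponents (n d c : nat) : (c <= d)%N ->
  ('C((n + d).+1, n.+1) <=
   #|[set kt : 'I_c.+1 * {ffun 'I_n -> 'I_d.+1} |
        kt.1 + \sum_i val (kt.2 i) <= d]| + 'C(n + (d - c), n.+1))%N.
Proof.
move=> cd; rewrite -(hockey_stick n cd) leq_add2r -sum1dep_card.
rewrite (eq_bigl (fun kt : 'I_c.+1 * {ffun 'I_n -> 'I_d.+1} =>
   xpredT kt.1 && (\sum_i val (kt.2 i) <= d - kt.1)%N)); last first.
  move=> [k t] /=; rewrite leq_subRL //.
  by apply: leq_trans cd; rewrite -ltnS.
rewrite -(pair_big_dep xpredT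
  (fun (k : 'I_c.+1) (t : {ffun 'I_n -> 'I_d.+1}) =>
     \sum_i val (t i) <= d - k)%N (fun _ _ => 1%N)) /=.
apply: leq_sum => k _; rewrite sum1dep_card.
exact/card_bounded_exponents/leq_subr.
Qed.

(** * Independence over the extension field and the dimension count *)

Section RankBound.
Variables (F : fieldType) (K : closedFieldType) (iota : {rmorphism F -> K}).

(** Independence means that the matrix of coefficients has full row rank, and the rank is unchanged
    by the field embedding [iota]. *)
Lemma free_map_dhomog (n d r : nat) (Fs : r.-tuple (dhomog n.+1 F d))
    (k : 'I_r -> K) : free Fs ->
  \sum_i k i *: map_mpoly iota (mpoly_of_dhomog (tnth Fs i)) = 0 ->
  forall i, k i = 0.
Proof.
move=> /freeP free_Fs kF0.
pose B := 'X_{1..n.+1 < d.+1}.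
pose M : 'M[F]_(r, #|{: B}|) :=
  \matrix_(i, j) (mpoly_of_dhomog (tnth Fs i))@_(bmnm (enum_val j)).
have M_free : row_free M.
  apply/inj_row_free => v vM0; apply/rowP => i; rewrite [RHS]mxE.
  move: i; apply: (free_Fs (v 0)); apply/val_inj; rewrite /= raddf_sum.
  apply/mpolyP => u; rewrite mcoeff0.
  under eq_bigr => i _ do rewrite -tnth_nth /=.
  have [ud|ud] := ltnP (mdeg u) d.+1.
    have := congr1 (fun A : 'M_(1, _) => A 0 (enum_rank (BMultinom ud))) vM0.
    rewrite !mxE => <-; rewrite raddf_sum; apply: eq_bigr => i _ /=.
    by rewrite mcoeffZ mxE enum_rankK.
  rewrite raddf_sum big1 //= => i _.
  rewrite mcoeffZ (dhomog_nemf_coeff (dhomog_is_dhomog (tnth Fs i))) ?mulr0 //.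
  by rewrite neq_ltn ud orbT.
have kM0 : (\row_i k i) *m map_mx iota M = 0.
  apply/matrixP => i j; rewrite ord1 !mxE {i}.
  transitivity
    ((\sum_i k i *: map_mpoly iota (mpoly_of_dhomog (tnth Fs i)))
       @_(bmnm (enum_val j))).
    rewrite raddf_sum; apply: eq_bigr => i _ /=.
    by rewrite !mxE mcoeffZ mcoeff_map_mpoly.
  by rewrite kF0 mcoeff0.
move=> i; have := row_free_inj (A := map_mx iota M).
rewrite row_free_map => /(_ 1%N M_free) inj.
have /rowP /(_ i) : \row_i k i = 0.
  by apply: inj; rewrite kM0 mul0mx.
by rewrite !mxE.
Qed.

(** Evaluating a linear relation between the images of [Fs] and the [G i] at the points [pt t]
    removes the first family, so the coefficients of the [G i] vanish, and then the others do. Both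
    families together are thus free in the space of forms of degree [d]. *)
Lemma rank_bound (n d r : nat) (Fs : r.-tuple (dhomog n.+1 F d)) (I : finType)
    (G : I -> {mpoly K[n.+1]}) (T : Type) (pt : T -> 'rV[K]_n.+1) :
  free Fs ->
  (forall t i, (map_mpoly iota (mpoly_of_dhomog (tnth Fs i))).@[pt t 0] = 0) ->
  (forall i, G i \is d.-homog) ->
  (forall b : I -> K, (forall t, \sum_i b i * (G i).@[pt t 0] = 0) ->
     forall i, b i = 0) ->
  (r + #|I| <= 'C(d + n, d))%N.
Proof.
move=> free_Fs F_van homG G_indep.
pose F' (i : 'I_r) : dhomog n.+1 K d :=
  DHomog (map_mpoly_homog iota (dhomog_is_dhomog (tnth Fs i))).
pose G' (i : 'I_#|I|) : dhomog n.+1 K d := DHomog (homG (enum_val i)).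
pose X := [tuple of [tuple F' i | i < r] ++ [tuple G' i | i < #|I|]].
have free_X : free X.
  apply/freeP => k; rewrite big_split_ord /=.
  under eq_bigr => i _ do
    rewrite -[nth _ _ _](tnth_nth _ X (lshift _ i)) tnth_lshift tnth_mktuple.
  under [X in _ + X]eq_bigr => i _ do
    rewrite -[nth _ _ _](tnth_nth _ X (rshift _ i)) tnth_rshift tnth_mktuple.
  move=> /(congr1 (@mpoly_of_dhomog _ _ _)).
  rewrite raddfD !raddf_sum /= => FG0.
  have kG : forall i, k (rshift r i) = 0.
    suff b0 : forall i : I, k (rshift r (enum_rank i)) = 0.
      by move=> i; rewrite -[i]enum_valK b0.
    apply: G_indep => t; have := congr1 (fun f => f.@[pt t 0]) FG0.
    rewrite mevalD meval0 !raddf_sum /= big1 ?add0r => [G0|i _]; last first.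
      by rewrite mevalZ F_van mulr0.
    rewrite -[RHS]G0 (reindex (@enum_val I predT)) /=; last first.
      exact/onW_bij/enum_val_bij.
    by apply: eq_bigr => i _; rewrite enum_valK mevalZ.
  have kF : forall i, k (lshift _ i) = 0.
    apply: (free_map_dhomog free_Fs); move: FG0.
    by rewrite [X in _ + X]big1 ?addr0 // => i _; rewrite kG scale0r.
  by move=> i; case: (split_ordP i) => j ->.
have : (\dim <<X>> <= \dim {:dhomog n.+1 K d})%N by rewrite dimvS ?subvf.
by rewrite dimvf (eqP free_X) size_tuple.
Qed.

End RankBound.

(** * Sections of the components *)

Lemma meval_line_polynomial (K : fieldType) (V : lmodType K) (n : nat)
    (p : {mpoly K[n]}) (x : V -> 'I_n -> K) :
  (forall u w t i, x (u + t *: w) i = x u i + t * x w i) ->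
  line_polynomial (fun v => p.@[x v]).
Proof.
move=> x_lin u w.
exists (\sum_(k <- msupp p)
          p@_k *: \prod_i ((x u i)%:P + x w i *: 'X) ^+ k i) => t.
rewrite mevalE horner_sum; apply: eq_bigr => k _.
rewrite hornerZ horner_prod; congr (_ * _); apply: eq_bigr => i _.
by rewrite horner_exp !hornerE x_lin mulrC.
Qed.

Section Sections.
Local Open Scope classical_set_scope.
Local Open Scope card_scope.
Variables (K : closedFieldType) (m : nat).
Local Notation PP := (projective_space K m).
Local Notation CV := 'cV[K]_m.+1.
Implicit Types (Z W X Y : set PP) (p : PP).

Lemma card_eq_injection (T : Type) (A : set T) (N : nat) : A #= `I_N ->
  exists f : 'I_N -> T, injective f /\ forall i, A (f i).
Proof.
move=> /card_set_bijP [g [_ _ g_surj]].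
have pre (i : 'I_N) : exists x, A x /\ g x = i.
  by have [x Ax gx] := g_surj i (ltn_ord i); exists x.
have [f fP] := choice pre.
exists f; split=> [i j fij|i]; last by case: (fP i).
have [_ gi] := fP i; have [_ gj] := fP j.
by apply/ord_inj; rewrite -gi -gj fij.
Qed.

(** A nonzero value cannot be the default of [xget], so it satisfies the defining property of the
    degree. *)
Lemma degree_general_section n Z : has_dimension Z n -> degree Z != 0%N ->
  for_general_forms (fun A : 'M[K]_(m.+1, n) =>
    Z `&` linear_section A #= `I_(degree Z)).
Proof.
move=> dimZ; rewrite /degree; case: xgetP => [delta _|_]; last by rewrite eqxx.
by move=> [n' dimZ' gen] _; rewrite (has_dimension_unique dimZ dimZ').
Qed.

(** The sum runs over the components of nonzero degree. Were there infinitely many, it would be 0 by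
    convention, against the strict inequality. *)
Lemma deg_dim_components n X c : (c < deg_dim n X)%N ->
  exists (s : nat) (Z : 'I_s -> set PP),
    [/\ injective Z, forall i, irreducible_component X (Z i),
        forall i, has_dimension (Z i) n, forall i, degree (Z i) != 0%N &
        (c < \sum_i degree (Z i))%N].
Proof.
rewrite /deg_dim; set sup := finite_support _ _ _.
have memS Z : Z \in sup ->
    [/\ irreducible_component X Z, has_dimension Z n & degree Z != 0%N].
  rewrite /sup; case: finite_supportP => // S _ _ SE ZS.
  suff [[compZ dimZ] /eqP degZ] : ([set Z | irreducible_component X Z /\
      has_dimension Z n] `&` (fun Z => degree Z) @^-1` [set~ 0%N]) Z by [].
  by rewrite -SE.
have sup_uniq : uniq sup by exact: finite_support_uniq.
rewrite (big_nth set0) big_mkord => c_lt.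
exists (size sup), (fun i => nth set0 sup i).
have nthS (i : 'I_(size sup)) := memS _ (mem_nth set0 (ltn_ord i)).
split=> // [i j /eqP|i|i|i]; try by case: (nthS i).
by rewrite nth_uniq // => /eqP/val_inj.
Qed.

Definition columns_mx n (f : nat -> CV) : 'M[K]_(m.+1, n) :=
  \matrix_(i, j) f j i 0.

Lemma columns_mx_surj n (A : 'M[K]_(m.+1, n)) : exists f, columns_mx n f = A.
Proof.
exists (fun j => if insub j is Some j' then col j' A else 0).
by apply/matrixP => i j; rewrite mxE valK mxE.
Qed.

Lemma linear_section_columns n (f : nat -> CV) p :
  linear_section (columns_mx n f) p <-> forall j, (j < n)%N -> hyperplane (f j) p.
Proof.
have colE (v : 'rV[K]_m.+1) (j : 'I_n) :
    (v *m columns_mx n f) 0 j = (v *m f j) 0 0.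
  by rewrite !mxE; apply: eq_bigr => i _; rewrite mxE.
split=> [secp j jn v vp|hp v vp].
  apply/matrixP => i k; rewrite !ord1 -(colE v (Ordinal jn)) secp //.
  by rewrite !mxE.
by apply/matrixP => i j; rewrite !ord1 colE (hp j) // !mxE.
Qed.

(** Puts genericity in the shape expected by [grid_avoidance]: a function on infinite sequences of
    forms that reads only the first [n]. *)
Lemma general_forms_line_polynomial n (P : 'M[K]_(m.+1, n) -> Prop) :
  for_general_forms P -> exists phi : (nat -> CV) -> K,
    [/\ line_polynomial phi, exists f, phi f != 0 &
        forall f, phi f != 0 -> P (columns_mx n f)].
Proof.
move=> [Phi Phi_neq0 PhiP].
exists (fun f => Phi.@[mxvec (columns_mx n f) 0]); split=> [||f]; last exact: PhiP.
  apply: meval_line_polynomial => u w t i.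
  by case/mxvec_indexP: i => i j; rewrite !mxvecE !mxE.
have [v vP] := mpoly_nonzero_point Phi_neq0.
have [f fE] := columns_mx_surj (vec_mx (\row_i v i) : 'M[K]_(m.+1, n)).
exists f; rewrite fE vec_mxK; apply: contra_neq vP => <-.
by apply: meval_eq => i; rewrite mxE.
Qed.

Lemma projective_point_inj p p' (v : 'rV[K]_m.+1) :
  v != 0 -> v \in \val p -> v \in \val p' -> p = p'.
Proof.
move=> v0 vp vp'; apply: val_inj => /=.
by rewrite (projective_point_line vp v0) (projective_point_line vp' v0).
Qed.

Lemma normalized_point p (h0 : CV) : ~ hyperplane h0 p ->
  exists2 v : 'rV[K]_m.+1, v \in \val p & (v *m h0) 0 0 = 1.
Proof.
move=> nh; pose x := (repr_vector p *m h0) 0 0.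
have x0 : x != 0.
  apply: contra_notN nh => /eqP x0 v.
  rewrite (projective_point_line (repr_vector_in p) (repr_vector_neq0 p)).
  move=> /vlineP [k ->]; apply/matrixP => i j; rewrite !ord1.
  by rewrite -scalemxAl mxE -/x x0 mulr0 mxE.
exists (x^-1 *: repr_vector p); first by rewrite memvZ ?repr_vector_in.
by rewrite -scalemxAl mxE -/x mulVf.
Qed.

Section Components.
Variables (s n c d : nat) (Z : 'I_s -> set PP).
Hypotheses (irrZ : forall i, irreducible_set (Z i))
  (dimZ : forall i, has_dimension (Z i) n)
  (degZ : forall i, degree (Z i) != 0%N)
  (sepZ : forall i j, i != j -> ~ Z i `<=` Z j)
  (sumZ : (c < \sum_i degree (Z i))%N).

(** The sets [Z i] meet each other and the hyperplane of [h0] in proper subsets, hence in smaller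
    dimension, and the [n] hyperplanes of each grid point can be made to miss these. Points on
    different [Z i] are then distinct, so the degrees add up to at least [c.+1] points. *)
Lemma grid_sections : exists (h0 : CV) (h : nat -> CV) (e : 'I_n -> 'I_d.+1 -> K),
  (forall i, injective (e i)) /\
  forall a : {ffun 'I_n -> 'I_d.+1}, exists P : 'I_c.+1 -> PP,
    injective P /\ forall x,
      [/\ exists i, Z i (P x), ~ hyperplane h0 (P x) &
          forall j : 'I_n, hyperplane (h j - e j (a j) *: h0) (P x)].
Proof.
have algZ i : algebraic_set (Z i) by exact: irreducible_algebraic.
have neZ i : exists p, Z i p by case: (irrZ i).
have [q qZ] := choice neZ.
have [h0 h0P] := common_nonzero (fun i => line_polynomial_mulmx (repr_vector (q i)))
  (fun i => mulmx_cV_neq0 (repr_vector_neq0 (q i))).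
have [Phi PhiP] := choice (fun i =>
  general_forms_line_polynomial (degree_general_section (dimZ i) (degZ i))).
have lp_Phi i : line_polynomial (Phi i) by case: (PhiP i).
have nz_Phi i : exists f, Phi i f != 0 by case: (PhiP i).
(* Diagonal pairs encode the part of [Z i] on the hyperplane of [h0], the other pairs the
   intersections of two components. *)
pose Y (ij : 'I_s * 'I_s) := Z ij.1 `&`
  (if ij.1 == ij.2 then hyperplane h0 else Z ij.2).
have algY ij : algebraic_set (Y ij).
  by apply: algebraic_setI => //; case: ifP => // _; exact: algebraic_hyperplane.
have Y_proper ij : Y ij `<` Z ij.1.
  split; first exact: subIsetl.
  case: ij => i j; rewrite /Y /=; case: eqVneq => [_|ij] sub.
    by have [_] := sub _ (qZ i); apply: not_hyperplane; exact: h0P.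
  by apply: (sepZ ij) => p /sub [].
have nchY ij : ~ irreducible_chain (Y ij) n.
  by apply: proper_subset_chain (irrZ ij.1) (Y_proper ij) _; case: (dimZ ij.1).
have [|_|h [e [e_inj eP]]] := @grid_avoidance K m h0 d.+1 n ('I_s * 'I_s)%type
  (fun=> fun f => \prod_i Phi i f) Y _ _ algY nchY.
- by move=> _; exact: line_polynomial_prod.
- exact: common_nonzero_seq.
exists h0, h, e; split=> [i|a]; first exact: e_inj.
pose a' i := if insub i is Some i' then a i' else ord0.
have a'E (j : 'I_n) : a' j = a j by rewrite /a' valK.
pose L : set PP := [set p | forall j : 'I_n, hyperplane (h j - e j (a j) *: h0) p].
have LP p : L p <-> forall j, (j < n)%N -> hyperplane (h j - e j (a' j) *: h0) p.
  split=> [Lp j jn|Lp j]; last by rewrite -a'E; exact: Lp.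
  by have := Lp (Ordinal jn); rewrite -a'E.
have disjY ij p : Y ij p -> ~ L p.
  by move=> Yp /LP; have [_] := eP ij a'; apply.
have cardZ i : Z i `&` L #= `I_(degree (Z i)).
  have [[g gP gE] _] := eP (i, i) a'.
  have [_ _ /(_ g)] := PhiP i.
  have -> : linear_section (columns_mx n g) = L.
    apply/seteqP; split=> p.
      move=> /linear_section_columns secp; apply/LP => j jn.
      by rewrite -gE //; exact: secp.
    move=> /LP Lp; apply/linear_section_columns => j jn.
    by rewrite gE //; exact: Lp.
  by apply; move/prodf_neq0: gP => /(_ i isT).
have [pts ptsP] : exists pts : forall i, 'I_(degree (Z i)) -> PP,
    forall i, injective (pts i) /\ forall x, (Z i `&` L) (pts i x).
  exists (fun i => sval (cid (card_eq_injection (cardZ i)))) => i.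
  by case: cid.
pose Q (ix : {i : 'I_s & 'I_(degree (Z i))}) := pts (tag ix) (tagged ix).
have cQ : (c.+1 <= #|{: {i : 'I_s & 'I_(degree (Z i))}}|)%N.
  rewrite card_tagged sumnE big_map big_enum /=.
  by under eq_bigr do rewrite card_ord.
have Q_inj : injective Q.
  move=> [i x] [j y]; rewrite /Q /= => ptsE.
  have [injx /(_ x) [Zix Lx]] := ptsP i; have [_ /(_ y) [Zjy Ly]] := ptsP j.
  have [ij|ij] := eqVneq i j.
    by subst j; rewrite (injx _ _ ptsE).
  case: (disjY (i, j) (pts i x)) => //; split=> //=.
  by rewrite (negPf ij) ptsE.
exists (fun x => Q (enum_val (widen_ord cQ x))); split=> [x y|x].
  by move=> /Q_inj /enum_val_inj /(congr1 val) /= /val_inj.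
case: (enum_val _) => i y; rewrite /Q /=; have [_ /(_ y) [Zy Ly]] := ptsP i.
split=> //; first by exists i.
by move=> hy; apply: (disjY (i, i) (pts i y)) => //; split=> //=; rewrite eqxx.
Qed.

(** Scaling to the value 1 on [h0] turns the equations of the section into [h j] having the value
    [e j (a j)]. A form [u] separating the points over each [a] exists because only finitely many
    pairs must be told apart. *)
Lemma normalized_grid_sections :
  exists (h0 u : CV) (h : nat -> CV) (e : 'I_n -> 'I_d.+1 -> K)
    (v : {ffun 'I_n -> 'I_d.+1} -> 'I_c.+1 -> 'rV[K]_m.+1),
  [/\ forall i, injective (e i),
      forall a x, exists i p, Z i p /\ v a x \in \val p,
      forall a x, (v a x *m h0) 0 0 = 1,
      forall a x (j : 'I_n), (v a x *m h j) 0 0 = e j (a j) &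
      forall a, injective (fun x => (v a x *m u) 0 0)].
Proof.
have [h0 [h [e [e_inj eP]]]] := grid_sections.
have [P PP_] := choice eP.
have ex_v (ax : {ffun 'I_n -> 'I_d.+1} * 'I_c.+1) : exists v : 'rV[K]_m.+1,
    v \in \val (P ax.1 ax.2) /\ (v *m h0) 0 0 = 1.
  have [_ /(_ ax.2) [_ /normalized_point [v vP vh] _]] := PP_ ax.1.
  by exists v.
have [v vP] := choice ex_v.
have v_neq0 ax : v ax != 0.
  apply/negP => /eqP v0; have [_ /eqP] := vP ax.
  by rewrite v0 mul0mx mxE eq_sym oner_eq0.
(* For equal indices a dummy nonzero vector replaces the zero difference, so that [common_nonzero]
   applies to all triples. *)
pose diff (axy : {ffun 'I_n -> 'I_d.+1} * ('I_c.+1 * 'I_c.+1)) :=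
  let: (a, (x, y)) := axy in
  if x == y then const_mx 1 else v (a, x) - v (a, y).
have diff_neq0 axy : diff axy != 0.
  case: axy => a [x y]; rewrite /diff; have [_|xy] := eqVneq x y.
    by apply/negP => /eqP /rowP /(_ ord0) /eqP; rewrite !mxE oner_eq0.
  rewrite subr_eq0; apply: contra_neq xy => vxy.
  have [P_inj _] := PP_ a; apply: P_inj.
  apply: (projective_point_inj (v_neq0 (a, x))); first by case: (vP (a, x)).
  by rewrite vxy; case: (vP (a, y)).
have [u uP] := common_nonzero (fun axy => line_polynomial_mulmx (diff axy))
  (fun axy => mulmx_cV_neq0 (diff_neq0 axy)).
exists h0, u, h, e, (fun a x => v (a, x)); split=> //.
- move=> a x; have [_ /(_ x) [[i Zp] _ _]] := PP_ a.
  by exists i, (P a x); have [] := vP (a, x).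
- by move=> a x; case: (vP (a, x)).
- move=> a x j; have [_ /(_ x) [_ _ /(_ j) hp]] := PP_ a.
  have [vp vh0] := vP (a, x); have /eqP := hp _ vp.
  by rewrite mulmxBr -scalemxAr subr_eq0 => /eqP ->; rewrite mxE vh0 mulr1.
- move=> a x y /= uxy; apply: contrapT => /eqP xy.
  have /eqP := uP (a, (x, y)); rewrite /= (negPf xy) mulmxBl mxE [X in _ + X]mxE.
  by rewrite uxy subrr; apply.
Qed.

End Components.
End Sections.

(** For a fixed [a], a polynomial of degree at most [c] has the [c.+1] distinct roots [y a x], so
    its coefficients vanish; these are polynomials in the grid coordinates, to which
    [grid_independence] applies. *)
Lemma poly_grid_independence (K : fieldType) (n d c : nat)
    (e : 'I_n -> 'I_d.+1 -> K) (y : {ffun 'I_n -> 'I_d.+1} -> 'I_c.+1 -> K)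
    (b : 'I_c.+1 -> {ffun 'I_n -> 'I_d.+1} -> K) :
  (forall i, injective (e i)) -> (forall a, injective (y a)) ->
  (forall a x, \sum_k \sum_t b k t * (y a x ^+ k * \prod_i e i (a i) ^+ t i) = 0) ->
  forall k t, b k t = 0.
Proof.
move=> e_inj y_inj b0 k; apply: (grid_independence e_inj) => a.
pose coef (k : 'I_c.+1) := \sum_t b k t * \prod_i e i (a i) ^+ t i.
pose q : {poly K} := \poly_(k < c.+1) coef (inord k).
suff q0 : q = 0.
  have := congr1 (fun q : {poly K} => q`_k) q0.
  by rewrite coef_poly ltn_ord inord_val coef0.
apply: (@roots_geq_poly_eq0 _ _ (codom (y a))).
- apply/allP => _ /codomP [x ->]; rewrite /root horner_poly.
  apply/eqP; rewrite -[RHS](b0 a x); apply: eq_bigr => j _.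
  rewrite inord_val /coef mulr_suml.
  by apply: eq_bigr => t _; rewrite [y a x ^+ j * _]mulrC mulrA.
- by rewrite map_inj_uniq ?enum_uniq.
- by rewrite size_codom card_ord size_poly.
Qed.

(** * The bound on the number of independent forms *)

Section Bound.
Variables (F : fieldType) (K : closedFieldType) (iota : {rmorphism F -> K}).

(* The binomial difference counts the monomials of degree [d] in n+2 variables
   having degree at most [c] in one of them. *)
Lemma deg_dim_hilbert_bound (m d n c r : nat) (Fs : r.-tuple (dhomog m.+1 F d)) :
  (c <= d)%N -> free Fs -> (c < deg_dim n (projV iota Fs))%N ->
  (r + 'C((n + d).+1, n.+1) <= 'C(d + m, d) + 'C(n + (d - c), n.+1))%N.
Proof.
move=> cd free_Fs /deg_dim_components [s [Z [Z_inj compZ dimZ degZ sumZ]]].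
have irrZ i : irreducible_set (Z i) by case: (compZ i).
have sepZ i j : i != j -> ~ (Z i `<=` Z j)%classic.
  move=> ij sub; move/eqP: ij; apply; apply: Z_inj; apply/esym.
  have [_ _ maxZi] := compZ i; have [_ ZjX _] := compZ j.
  exact: maxZi (irrZ j) sub ZjX.
have [h0 [u [h [e [v [e_inj vZ vh0 vh vu]]]]]] :=
  normalized_grid_sections d irrZ dimZ degZ sepZ sumZ.
pose A := [set kt : 'I_c.+1 * {ffun 'I_n -> 'I_d.+1} |
             (kt.1 + \sum_i val (kt.2 i) <= d)%N].
(* The power of [h0] completes the degree to [d] and takes the value 1 at every [v a x]. *)
pose G (kt : {kt in A}) : {mpoly K[m.+1]} :=
  linear_form u ^+ (val kt).1 * \prod_(i < n) linear_form (h i) ^+ (val kt).2 i *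
  linear_form h0 ^+ (d - ((val kt).1 + \sum_i val ((val kt).2 i))).
have homG kt : G kt \is d.-homog.
  case: kt => [[k t] ktA]; rewrite /G /=.
  have ktd : (k + \sum_i val (t i) <= d)%N by move: ktA; rewrite inE.
  rewrite -[X in _ \is X.-homog](subnKC ktd).
  apply: dhomogM; last exact: linear_form_exp_homog.
  apply: dhomogM; first exact: linear_form_exp_homog.
  by apply: dhomog_bigprod => i; exact: linear_form_exp_homog.
have G_v kt a x : (G kt).@[v a x 0] =
    (v a x *m u) 0 0 ^+ (val kt).1 * \prod_(i < n) e i (a i) ^+ (val kt).2 i.
  rewrite !mevalM !rmorphXn /= !linear_formE vh0 expr1n mulr1; congr (_ * _).
  rewrite rmorph_prod; apply: eq_bigr => i _.
  by rewrite rmorphXn /= linear_formE vh.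
have cardA : (r + #|{: {kt in A}}| <= 'C(d + m, d))%N.
  apply: (rank_bound (iota := iota) (Fs := Fs) (G := G)
    (pt := fun ax : {ffun 'I_n -> 'I_d.+1} * 'I_c.+1 => v ax.1 ax.2)) => //.
    move=> [a x] i /=; have [j [p [Zp vp]]] := vZ a x.
    have [_ ZX _] := compZ j; apply: (ZX p Zp) vp.
    by exists i.
  move=> b b0 kt.
  (* The coefficients are extended by 0 to all pairs of exponents, including those of total degree
     above [d]. *)
  pose b' k t : K := if insub (k, t) is Some kt' then b kt' else 0.
  have -> : b kt = b' (val kt).1 (val kt).2 by rewrite /b' -surjective_pairing valK.
  apply: (poly_grid_independence e_inj vu) => a x; rewrite pair_bigA /=.
  rewrite (bigID (mem A)) /= addrC big1 ?add0r => [|[k t] ktA]; last first.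
    by rewrite /b' insubN ?mul0r.
  rewrite big_sub -[RHS](b0 (a, x)); apply: eq_bigr => kt' _.
  by rewrite G_v /b' -surjective_pairing valK.
rewrite card_sig in cardA.
have := card_exponents n cd.
rewrite -(leq_add2l r) addnA => /leq_trans; apply.
by rewrite leq_add2r (leq_trans _ cardA) // leq_add2l.
Qed.

End Bound.

Theorem proposition5 (Fq : finFieldType) (K : closedFieldType)
    (iota : {rmorphism Fq -> K}) (HK : is_algebraic_closure iota)
    (m d l c r : nat)
    (Hm : (1 <= m)%N) (Hd : (1 <= d)%N)
    (Hl : (1 <= l <= m)%N) (Hc : (1 <= c <= d)%N)
    (Hr_lower : 'C(m + d, d)%:Z - 'C(m + d + 1 - l, d)%:Z
                + (binz (m + d - l - c) (d%:Z - c%:Z - 1))%:Z < r%:Z)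
    (Hr_upper : (r <= 'C(m + d, d))%N)
    (Fs : r.-tuple (dhomog m.+1 Fq d)) (Hfree : free Fs) :
  (deg_dim (m - l) (projV iota Fs) <= c)%N.
Proof.
have /andP [_ cd] := Hc; have /andP [_ lm] := Hl.
rewrite leqNgt; apply/negP => /(deg_dim_hilbert_bound cd Hfree).
have -> : 'C((m - l + d).+1, (m - l).+1) = 'C(m + d + 1 - l, d).
  have -> : (m + d + 1 - l = (m - l).+1 + d)%N by lia.
  by rewrite -addSn -[RHS]bin_sub ?leq_addl // addnK.
have -> : 'C(m - l + (d - c), (m - l).+1) =
          binz (m + d - l - c) (d%:Z - c%:Z - 1).
  have -> : (m + d - l - c = m - l + (d - c))%N by lia.
  (* For [c = d] the lower index of [binz] is -1, and both sides are 0. *)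
  move: cd; rewrite leq_eqVlt => /predU1P [->|cd].
    by rewrite subrr sub0r subnn addn0 bin_small.
  have -> : d%:Z - c%:Z - 1 = (d - c.+1)%N :> int by lia.
  have -> : (m - l + (d - c) = (m - l).+1 + (d - c.+1))%N by lia.
  by rewrite /= -[RHS]bin_sub ?leq_addl // addnK.
rewrite (addnC d m); lia.
Qed.
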